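(* The coefficient $G_2$ is dimension stable. That is, let $\{\mu^{(n)}\}_{n\in\mathbb{N}}$ be a sequence such that, for every $n$, $\mu^{(n)}$ is a probability measure on $\mathbb{R}^n$ with finite second moment, the entries of the random vector $\mathbf{X}^{(n)}=(X^{(n)}_1,\dots,X^{(n)}_n)\sim\mu^{(n)}$ are independent, and the marginal of $\mu^{(n)}$ on the first $n-1$ coordinates is $\mu^{(n-1)}$ (for $n\ge2$). Let $m^{(n)}_n\neq0$ and $\sigma^{(n)}_{n,n}>0$ be the mean and the standard deviation of $X^{(n)}_n$. If $\lim_{n\to\infty}\frac{\sigma^{(n)}_{n,n}}{|m^{(n)}_n|}$ exists and is finite, then $\lim_{n\to\infty}G_2(\mu^{(n)})$ exists and $$\lim_{n\to\infty}G_2(\mu^{(n)})=\lim_{n\to\infty}\frac{\sigma^{(n)}_{n,n}}{|m^{(n)}_n|}.$$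
   Context: For a probability measure $\mu$ on $\mathbb{R}^n$ with finite second moment, mean $\mathbf{m}\neq 0$ and invertible covariance matrix $\Sigma$, $$G_2(\mu):=\Bigg(\frac{1}{2\mathbf{m}^T\Sigma^{-1}\mathbf{m}}\int_{\mathbb{R}^n}\int_{\mathbb{R}^n}(\mathbf{x}-\mathbf{y})^T\Sigma^{-1}(\mathbf{x}-\mathbf{y})\,\mu(d\mathbf{x})\,\mu(d\mathbf{y})\Bigg)^{1/2}.$$ *)

(* Defs.v *)
From HB Require Import structures.
From mathcomp Require Import all_boot all_order all_algebra.
From mathcomp Require Import all_classical all_reals all_analysis.

Set Implicit Arguments.
Unset Strict Implicit.
Unset Printing Implicit Defensive.

Import Order.TTheory GRing.Theory Num.Theory.
Import numFieldNormedType.Exports.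

Local Open Scope classical_set_scope.
Local Open Scope ring_scope.

(* R^n is n.-tuple R with the product sigma-algebra of the library, which is
   the Borel one; for matrix products, points are turned into column vectors. *)
Definition cvec (R : realType) (n : nat) (x : n.-tuple R) : 'cV[R]_n :=
  \col_i tnth x i.

Definition coord_proj (R : realType) (n : nat) (i : 'I_n) (x : n.-tuple R) : R :=
  tnth x i.

Definition init_proj (R : realType) (n : nat) (x : n.+1.-tuple R) :
    n.-tuple R :=
  [tuple tnth x (widen_ord (leqnSn n) i) | i < n].

Definition finite_second_moment (R : realType) (n : nat)
    (mu : probability (n.-tuple R) R) : Prop :=
  (\int[mu]_x (\sum_(i < n) tnth x i ^+ 2)%:E < +oo)%E.

Definition mutually_independent d d' (T : measurableType d)
    (T' : measurableType d') (R : realType) (P : probability T R)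
    (I : finType) (X : I -> T -> T') : Prop :=
  forall (J : {set I}) (A : I -> set T'),
    (forall i, measurable (A i)) ->
    P (\bigcap_(i in [set` J]) X i @^-1` A i) =
      (\prod_(i in J) P (X i @^-1` A i))%E.

Definition mean_vec (R : realType) (n : nat)
    (mu : probability (n.-tuple R) R) : 'cV[R]_n :=
  \col_i fine 'E_mu[coord_proj i].

Definition cov_mx (R : realType) (n : nat)
    (mu : probability (n.-tuple R) R) : 'M[R]_n :=
  \matrix_(i, j) fine (covariance mu (coord_proj i) (coord_proj j)).

Definition std_dev d (T : measurableType d) (R : realType)
    (P : probability T R) (X : T -> R) : R :=
  Num.sqrt (fine 'V_P[X]).

(* v^T A v, the 1 x 1 matrix being read as a scalar. *)
Definition qform (R : realType) (n : nat) (A : 'M[R]_n) (v : 'cV[R]_n) : R :=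
  (v^T *m A *m v) 0 0.

(* Only meaningful when mu has a finite second moment, a nonzero mean and an
   invertible covariance matrix; the value is arbitrary otherwise. *)
Definition G2 (R : realType) (n : nat) (mu : probability (n.-tuple R) R) : R :=
  let S' := invmx (cov_mx mu) in
  Num.sqrt ((2 * qform S' (mean_vec mu))^-1 *
    fine (\int[mu]_x \int[mu]_y (qform S' (cvec x - cvec y))%:E)%E).

(* Main.v *)
Require Import Defs.
From HB Require Import structures.
From mathcomp Require Import all_boot all_order all_algebra.
From mathcomp Require Import all_classical all_reals all_analysis.
From mathcomp Require Import measurable_realfun ring.

Set Implicit Arguments.
Unset Strict Implicit.
Unset Printing Implicit Defensive.

Import Order.TTheory GRing.Theory Num.Theory.
Import numFieldNormedType.Exports.

Local Open Scope classical_set_scope.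
Local Open Scope ring_scope.

(* Independence makes the covariance matrix diagonal (the joint law of two
   coordinates is a product measure, so Fubini applies), and consistency of the
   marginals makes the mean m_i and the variance s_i^2 of the i-th coordinate
   independent of n.  The double integral in G2 then equals 2 n, whence
     G2 (mu n) ^ 2 = n / (\sum_i m_i^2 / s_i^2),
   the harmonic mean of the squared ratios s_i^2 / m_i^2.  Harmonic means
   converge by Cesaro's lemma applied to the inverses or, when the limit is 0,
   because they are dominated by arithmetic means. *)

(** * Independence and expectations of products *)

Lemma integral_indep d d1 d2 (T : measurableType d) (T1 : measurableType d1)
    (T2 : measurableType d2) (R : realType) (P : probability T R)
    (X : {mfun T >-> T1}) (Y : {mfun T >-> T2}) (f : T1 * T2 -> \bar R) :
    (forall A B, measurable A -> measurable B ->
       P (X @^-1` A `&` Y @^-1` B) = (P (X @^-1` A) * P (Y @^-1` B))%E) ->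
    measurable_fun setT f ->
    P.-integrable setT (fun w => f (X w, Y w)) ->
  (\int[P]_w f (X w, Y w) =
   \int[distribution P X]_x \int[distribution P Y]_y f (x, y))%E.
Proof.
move=> indep mf intf.
have mZ : measurable_fun setT (fun w => (X w, Y w)) by exact: measurable_fun_pair.
pose Z : {mfun T >-> (T1 * T2)%type} :=
  HB.pack (fun w => (X w, Y w)) (isMeasurableFun.Build _ _ _ _ _ mZ).
have jointE A : measurable A ->
    (distribution P X \x distribution P Y)%E A = distribution P Z A.
  (* Independence says that the joint law and the product of the marginals agree on measurable
     rectangles; uniqueness of the product measure extends this to every [A]. *)
  apply: (@product_measure_unique _ _ _ _ _ _ _ (distribution P Z)) => B C mB mC.
  by rewrite /= /distribution /pushforward -indep.
have intZ : (distribution P Z).-integrable setT f.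
  exact: (integrable_pushforward mZ mf).
(* Fubini asks for integrability against the product measure, which is inherited from the joint law
   because the two measures coincide. *)
rewrite (integral12_prod_meas1 (f := f)); last first.
  move/integrableP : intZ => [_ ltoo]; apply/integrableP; split => //.
  by rewrite (eq_measure_integral (distribution P Z))// => A mA _; exact: jointE.
transitivity (\int[distribution P Z]_z f z)%E.
  by rewrite integral_distribution.
by apply: eq_measure_integral => A mA _ /=; rewrite -jointE.
Qed.

Lemma expectation_mul_indep d (T : measurableType d) (R : realType)
    (P : probability T R) (X Y : T -> R) :
    (forall A B : set R, measurable A -> measurable B ->
       P (X @^-1` A `&` Y @^-1` B) = (P (X @^-1` A) * P (Y @^-1` B))%E) ->
    X \in Lfun P 2%:E -> Y \in Lfun P 2%:E ->
  ('E_P[X * Y]%R = 'E_P[X] * 'E_P[Y])%E.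
Proof.
move=> indep X2 Y2.
have Pfin : P setT \is a fin_num := fin_num_measure P _ measurableT.
have [X1 Y1] := (Lfun_subset12 Pfin X2, Lfun_subset12 Pfin Y2).
have /Lfun1_integrable iXY := Lfun2_mul_Lfun1 X2 Y2.
have /Lfun1_integrable iX := X1.
have /Lfun1_integrable iY := Y1.
(* Measurability is recovered from integrability, so that the bare functions [X] and [Y] can be
   bundled as [integral_indep] requires. *)
have mX : measurable_fun setT X by apply/measurable_EFinP; case/integrableP: iX.
have mY : measurable_fun setT Y by apply/measurable_EFinP; case/integrableP: iY.
pose X' : {mfun T >-> measurableTypeR R} :=
  HB.pack X (isMeasurableFun.Build _ _ T (measurableTypeR R) X mX).
pose Y' : {mfun T >-> measurableTypeR R} :=
  HB.pack Y (isMeasurableFun.Build _ _ T (measurableTypeR R) Y mY).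
have idE (Z : {mfun T >-> measurableTypeR R}) : P.-integrable setT (EFin \o Z) ->
  ((distribution P Z).-integrable setT EFin /\
   \int[distribution P Z]_y y%:E = 'E_P[Z])%E.
  move=> iZ; split; last by rewrite unlock integral_distribution.
  exact: (integrable_pushforward (measurable_funPT Z)).
have [idX EX] := idE X' iX.
have [idY EY] := idE Y' iY.
rewrite [in LHS]unlock.
rewrite (@integral_indep _ _ _ _ _ _ _ _ X' Y' (fun z => (z.1 * z.2)%:E))//; last first.
  by apply/measurable_EFinP; exact: measurable_funM.
under eq_integral => x _.
  under eq_integral do rewrite /= EFinM.
  rewrite integralZl// EY.
  over.
by rewrite /= -(fineK (expectation_fin_num Y1)) integralZr// EX.
Qed.

(** * Second moments and covariances of the coordinates *)

Lemma Lfun2_sqr d (T : measurableType d) (R : realType)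
    (mu : {measure set T -> \bar R}) (f : T -> R) :
    measurable_fun setT f -> (\int[mu]_x (f x ^+ 2)%:E < +oo)%E ->
  f \in Lfun mu 2%:E.
Proof.
move=> mf f2; rewrite inE; apply/andP; split; rewrite inE//=.
rewrite /finite_norm unlock poweR_lty//; apply: le_lt_trans f2.
by under eq_integral => x _ do rewrite poweR_EFin powR_mulrn// -normrX ger0_norm ?sqr_ge0//.
Qed.

Lemma measurable_coord_proj (R : realType) (n : nat) (i : 'I_n) :
  measurable_fun setT (@coord_proj R n i).
Proof. exact: measurable_tnth. Qed.

(** A single squared coordinate is dominated by the sum of all of them, whose integral is finite. *)
Lemma Lfun2_coord_proj (R : realType) (n : nat) (mu : probability (n.-tuple R) R)
    (i : 'I_n) :
  finite_second_moment mu -> @coord_proj R n i \in Lfun mu 2%:E.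
Proof.
move=> mu2; apply: Lfun2_sqr; first exact: measurable_coord_proj.
apply: le_lt_trans mu2; apply: ge0_le_integral => //.
- by move=> x _; rewrite lee_fin sqr_ge0.
- by apply/measurable_EFinP/measurable_funX; exact: measurable_coord_proj.
- apply/measurable_EFinP; apply: measurable_sum => j.
  by apply: measurable_funX; exact: measurable_coord_proj.
- move=> x _; rewrite lee_fin (bigD1 i)//= lerDl.
  by apply: sumr_ge0 => j _; exact: sqr_ge0.
Qed.

Lemma mutually_independent2 d d' (T : measurableType d) (T' : measurableType d')
    (R : realType) (P : probability T R) (I : finType) (X : I -> T -> T')
    (i j : I) (A B : set T') :
    mutually_independent P X -> i != j -> measurable A -> measurable B ->
  P (X i @^-1` A `&` X j @^-1` B) = (P (X i @^-1` A) * P (X j @^-1` B))%E.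
Proof.
(* Only the values of [C] at [i] and [j] matter, since the index set is [{i, j}]; the value [B]
   elsewhere is a filler. *)
move=> indep ij mA mB; pose C k := if k == i then A else B.
have := indep [set i; j]%SET C; rewrite big_setU1 ?big_set1 ?inE//=.
rewrite /C eqxx eq_sym (negbTE ij) => <-; last by move=> k; case: ifP.
congr (P _); apply/seteqP; split => x /=.
  move=> [XA XB] k /=; rewrite !inE => /orP[] /eqP->; first by rewrite eqxx.
  by rewrite eq_sym (negbTE ij).
move=> XC; split.
  by have := XC i; rewrite /= !inE eqxx; apply.
by have := XC j; rewrite /= !inE eqxx orbT eq_sym (negbTE ij); apply.
Qed.

Lemma covariance_indep d (T : measurableType d) (R : realType)
    (P : probability T R) (X Y : T -> R) :
    (forall A B : set R, measurable A -> measurable B ->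
       P (X @^-1` A `&` Y @^-1` B) = (P (X @^-1` A) * P (Y @^-1` B))%E) ->
    X \in Lfun P 2%:E -> Y \in Lfun P 2%:E ->
  covariance P X Y = 0%E.
Proof.
move=> indep X2 Y2.
have Pfin : P setT \is a fin_num := fin_num_measure P _ measurableT.
have [X1 Y1] := (Lfun_subset12 Pfin X2, Lfun_subset12 Pfin Y2).
rewrite covarianceE ?Lfun2_mul_Lfun1// expectation_mul_indep//.
by rewrite subee// fin_numM// expectation_fin_num.
Qed.

Lemma cov_mx_indep (R : realType) (n : nat) (mu : probability (n.-tuple R) R) :
    finite_second_moment mu ->
    mutually_independent mu (fun i : 'I_n => @coord_proj R n i) ->
  cov_mx mu = diag_mx (\row_i fine ('V_mu[@coord_proj R n i])%E).
Proof.
move=> mu2 indep; apply/matrixP => i j; rewrite !mxE.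
have [->|ij] := eqVneq i j; first by rewrite mulr1n.
rewrite mulr0n covariance_indep ?Lfun2_coord_proj// => A B mA mB.
exact: mutually_independent2 indep ij mA mB.
Qed.

(** * Closed form of [G2] under independence *)

Lemma qform_diag (R : realType) (n : nat) (d : 'rV[R]_n) (v : 'cV[R]_n) :
  qform (diag_mx d) v = \sum_i d 0 i * v i 0 ^+ 2.
Proof.
rewrite /qform -mulmxA mul_diag_mx mxE; apply: eq_bigr => i _.
by rewrite !mxE mulrCA expr2.
Qed.

Lemma invmx_diag (R : realType) (n : nat) (d : 'rV[R]_n) :
  (forall i, d 0 i != 0) -> invmx (diag_mx d) = diag_mx (\row_i (d 0 i)^-1).
Proof.
move=> d0.
have dV : diag_mx d *m diag_mx (\row_i (d 0 i)^-1) = 1%:M.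
  apply/matrixP => i j; rewrite mul_diag_mx !mxE.
  by case: eqVneq => [->|_]; rewrite ?mulr0n ?mulr0// !mulr1n divff.
have [dU _] := mulmx1_unit dV.
by rewrite -[LHS]mulmx1 -dV mulKmx.
Qed.

(** A second moment is the variance plus the squared mean, here applied to [a - X], whose variance
    is that of [X]. *)
Lemma integral_sqr_sub d (T : measurableType d) (R : realType)
    (P : probability T R) (X : T -> R) (a : R) : X \in Lfun P 2%:E ->
  (\int[P]_y ((a - X y) ^+ 2)%:E =
   ((a - fine 'E_P[X]) ^+ 2 + fine 'V_P[X])%:E)%E.
Proof.
move=> X2.
have Pfin : P setT \is a fin_num := fin_num_measure P _ measurableT.
have X1 := Lfun_subset12 Pfin X2.
have cX2 : (cst a \- X)%R \in Lfun P 2%:E.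
  rewrite -[(cst a \- X)%R]/((cst a : T -> R) - X)%R rpredD ?lee1n//= => p1.
    exact: Lfun_cst.
  by rewrite rpredN.
have -> : (\int[P]_y ((a - X y) ^+ 2)%:E = 'E_P[(cst a \- X) ^+ 2]%R)%E.
  by rewrite unlock.
have := varianceB_cst_l a X2; rewrite varianceE//.
rewrite expectationB// ?Lfun_cst// expectation_cst.
have := expectation_fin_num X1; have := variance_fin_num X2.
case: ('E_P[X])%E => // m; case: ('V_P[X])%E => // v _ _ /=.
case: ('E_P[_])%E => // e [<-].
by congr EFin; ring.
Qed.

(** The centre [a] is arbitrary because both integrals in [G2] use this: the inner one with [a] the
    point [x], the outer one with [a] the mean. *)
Lemma integral_sum_sqr_sub (R : realType) (n : nat)
    (mu : probability (n.-tuple R) R) (w a : 'I_n -> R) :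
    finite_second_moment mu -> (forall i, 0 <= w i) ->
  (\int[mu]_y (\sum_i w i * (a i - tnth y i) ^+ 2)%:E =
   (\sum_i w i * ((a i - mean_vec mu i 0) ^+ 2 +
                  fine 'V_mu[@coord_proj R n i]))%:E)%E.
Proof.
move=> mu2 w0.
have mfun i : measurable_fun setT (fun y : n.-tuple R => (a i - tnth y i) ^+ 2).
  by apply/measurable_funX/measurable_funB => //; exact: measurable_coord_proj.
under eq_integral do rewrite -sumEFin.
rewrite ge0_integral_sum//; last 2 first.
- by move=> i; apply/measurable_EFinP/measurable_funM.
- by move=> i x _; rewrite lee_fin mulr_ge0 ?sqr_ge0.
rewrite -sumEFin; apply: eq_bigr => i _.
under eq_integral do rewrite EFinM.
rewrite ge0_integralZl_EFin//; last 2 first.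
- by move=> x _; rewrite lee_fin sqr_ge0.
- exact/measurable_EFinP.
by rewrite integral_sqr_sub ?Lfun2_coord_proj// mxE -EFinM.
Qed.

Lemma G2_indep (R : realType) (n : nat) (mu : probability (n.-tuple R) R) :
    finite_second_moment mu ->
    mutually_independent mu (fun i : 'I_n => @coord_proj R n i) ->
    (forall i, 0 < fine ('V_mu[@coord_proj R n i])%E) ->
  G2 mu = Num.sqrt (n%:R /
    \sum_i mean_vec mu i 0 ^+ 2 / fine ('V_mu[@coord_proj R n i])%E).
Proof.
move=> mu2 indep v0; rewrite /G2 cov_mx_indep// invmx_diag; last first.
  by move=> i; rewrite mxE gt_eqF.
set v := fun i => fine ('V_mu[@coord_proj R n i])%E.
have nE : n%:R = \sum_(i < n) 1 :> R by rewrite sumr_const card_ord.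
have vV0 i : 0 <= (v i)^-1 by rewrite invr_ge0 ltW// v0.
have qE x : qform (diag_mx (\row_i ((\row_i0 v i0) 0 i)^-1)) x =
    \sum_i (v i)^-1 * x i 0 ^+ 2.
  by rewrite qform_diag; apply: eq_bigr => i _; rewrite !mxE.
have mfun : measurable_fun setT (fun x : n.-tuple R =>
    \sum_i (v i)^-1 * (mean_vec mu i 0 - tnth x i) ^+ 2).
  apply: measurable_sum => i; apply: measurable_funM => //.
  by apply/measurable_funX/measurable_funB => //; exact: measurable_coord_proj.
(* Each integration contributes [n], as every weight [(v i)^-1] meets a variance [v i]. *)
have -> : (\int[mu]_x \int[mu]_y
    (qform (diag_mx (\row_i ((\row_i0 v i0) 0 i)^-1)) (cvec x - cvec y))%:E =
    (2 * n%:R)%:E)%E.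
  under eq_integral => x _.
    under eq_integral => y _.
      rewrite qE; under eq_bigr do rewrite !mxE.
      over.
    rewrite (integral_sum_sqr_sub (fun i => tnth x i))//.
    (* The square is turned around to [mean - x], so that the outer integral has the shape of
       [integral_sum_sqr_sub] again. *)
    rewrite (_ : \sum_i _ = \sum_i (v i)^-1 * (mean_vec mu i 0 - tnth x i) ^+ 2 + n%:R).
      rewrite EFinD.
      over.
    rewrite nE -big_split/=.
    apply: eq_bigr => i _; rewrite mulrDr mulVf ?gt_eqF ?v0//.
    by congr (_ * _ + _); ring.
  rewrite ge0_integralD//; last 2 first.
  - by move=> x _; rewrite lee_fin sumr_ge0// => i _; rewrite mulr_ge0// sqr_ge0.
  - exact/measurable_EFinP.
  rewrite integral_cst// (_ : (_ * _)%E = n%:R%:E); last first.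
    by rewrite -[RHS]mule1; congr (_ * _)%E; exact: probability_setT.
  rewrite integral_sum_sqr_sub//.
  rewrite -EFinD mulrDl mul1r; congr (_ + _)%:E.
  rewrite nE; apply: eq_bigr => i _.
  by rewrite subrr expr0n add0r mulVf ?gt_eqF ?v0.
rewrite qE invfM mulrACA mulVf ?mul1r// mulrC /=.
by congr (Num.sqrt (_ / _)); apply: eq_bigr => i _; rewrite mulrC.
Qed.

(** * Laws and moments of a coordinate across dimensions *)

Lemma eq_law_integral d d' (T : measurableType d) (T' : measurableType d')
    (R : realType) (P : probability T R) (Q : probability T' R)
    (X : T -> R) (Y : T' -> R) (f : R -> R) :
    measurable_fun setT X -> measurable_fun setT Y -> measurable_fun setT f ->
    (forall A, measurable A -> P (X @^-1` A) = Q (Y @^-1` A)) ->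
    P.-integrable setT (fun w => (f (X w))%:E) ->
    Q.-integrable setT (fun w => (f (Y w))%:E) ->
  (\int[P]_w (f (X w))%:E = \int[Q]_w (f (Y w))%:E)%E.
Proof.
move=> mX mY /measurable_EFinP mf law iX iY.
(* Both sides become integrals of [f] against pushforwards on the line, which are equal by [law]. *)
have := integral_pushforward mX mf iX measurableT.
rewrite preimage_setT => <-.
have := integral_pushforward mY mf iY measurableT.
rewrite preimage_setT => <-.
by apply: eq_measure_integral => A mA _; exact: law.
Qed.

Lemma eq_law_expectation_variance d d' (T : measurableType d)
    (T' : measurableType d') (R : realType) (P : probability T R)
    (Q : probability T' R) (X : T -> R) (Y : T' -> R) :
    (forall A : set R, measurable A -> P (X @^-1` A) = Q (Y @^-1` A)) ->
    X \in Lfun P 2%:E -> Y \in Lfun Q 2%:E ->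
  ('E_P[X] = 'E_Q[Y] /\ 'V_P[X] = 'V_Q[Y])%E.
Proof.
move=> law X2 Y2.
have /Lfun1_integrable iX := Lfun_subset12 (fin_num_measure P _ measurableT) X2.
have /Lfun1_integrable iY := Lfun_subset12 (fin_num_measure Q _ measurableT) Y2.
have mX : measurable_fun setT X by apply/measurable_EFinP; case/integrableP: iX.
have mY : measurable_fun setT Y by apply/measurable_EFinP; case/integrableP: iY.
have EXY : ('E_P[X] = 'E_Q[Y])%E.
  by rewrite unlock; exact: (eq_law_integral (f := id)).
split => //; rewrite !varianceE// EXY; congr (_ - _)%E.
rewrite unlock; apply: (eq_law_integral (f := fun x => x ^+ 2)) => //.
- exact: Lfun2_integrable_sqr.
- exact: Lfun2_integrable_sqr.
Qed.

(** Dropping the last coordinate repeatedly brings coordinate [i] into the last position. The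
    separate index [k] stays fixed while the type of [i] changes along the induction. *)
Lemma law_coord_proj (R : realType) (mu : forall n, probability (n.+1.-tuple R) R)
    (k n : nat) (i : 'I_n.+1) (A : set R) :
    (forall n (A : set (n.+1.-tuple R)), measurable A ->
       pushforward (mu n.+1) (@init_proj R n.+1) A = mu n A) ->
    measurable A -> i = k :> nat ->
  mu n (@coord_proj R n.+1 i @^-1` A) = mu k (@coord_proj R k.+1 ord_max @^-1` A).
Proof.
move=> marg mA; elim: n i => [|n IHn] i ik.
  by move: ik; rewrite ord1 => ik; case: _ / ik; rewrite (ord1 ord_max).
have [ilt|] := ltnP i n.+1.
  rewrite -(IHn (Ordinal ilt) ik) -(marg n); last first.
    rewrite -[X in measurable X]setTI.
    exact: (@measurable_coord_proj R n.+1 (Ordinal ilt) measurableT A mA).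
  congr (mu _ _); apply/funext => x.
  by rewrite /preimage/= /coord_proj tnth_mktuple; do 2 f_equal; apply/val_inj.
(* Here [i] is already the last coordinate, so [k] is [n.+1] and both sides are the same. *)
rewrite leq_eqVlt ltnNge -ltnS ltn_ord orbF => /eqP ni.
have -> : i = ord_max by apply/val_inj.
by move: ik; rewrite -ni => ik; case: _ / ik.
Qed.

(** * Convergence of harmonic means *)

Lemma harmonic_mean_gt0 (R : realFieldType) (u : R ^nat) (n : nat) :
  (forall n, 0 < u n) -> 0 < harmonic_mean u n.
Proof.
move=> u0; rewrite /harmonic_mean /= divr_gt0 ?ltr0n// /series/=.
rewrite big_nat_recl// ltr_pwDl ?invr_gt0//.
by apply: sumr_ge0 => i _; rewrite invr_ge0 ltW.
Qed.

Lemma harmonic_le_arithmetic_mean (R : realFieldType) (u : R ^nat) (n : nat) :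
  (forall n, 0 < u n) -> harmonic_mean u n <= arithmetic_mean u n.
Proof.
move=> u0; rewrite /harmonic_mean /arithmetic_mean /=.
set N : R := n.+1%:R; have N0 : 0 < N by rewrite ltr0n.
set S := series u n.+1.
have S0 : 0 < S.
  rewrite /S /series/= big_nat_recl// ltr_pwDl//.
  by apply: sumr_ge0 => i _; exact: ltW.
set t := N^-1 * S; have t0 : 0 < t by rewrite mulr_gt0// invr_gt0.
set V := series _ _.
(* The tangent to x |-> 1/x at the arithmetic mean t lies below its graph. *)
have tangent k : 2 / t - u k / t ^+ 2 <= (u k)^-1.
  rewrite -subr_ge0.
  have -> : (u k)^-1 - (2 / t - u k / t ^+ 2) = (u k - t) ^+ 2 / (u k * t ^+ 2).
    by field; rewrite !gt_eqF.
  by rewrite divr_ge0 ?sqr_ge0// mulr_ge0 ?sqr_ge0// ltW.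
have : \sum_(0 <= k < n.+1) (2 / t - u k / t ^+ 2) <= V.
  by apply: ler_sum => k _; exact: tangent.
rewrite sumrB -!mulr_suml big_const_nat subn0 iter_addr_0 -[_ *+ n.+1]mulr_natr.
rewrite -/N -[\sum_(0 <= i < _) _]/S.
(* Since [S = N * t], the tangent bounds add up to [N / t]; then [N / t <= V] rearranges to the
   claim. *)
have -> : 2 * N / t - S / t ^+ 2 = N / t.
  by rewrite /t; field; rewrite !gt_eqF.
move=> NtV; have V0 : 0 < V by apply: lt_le_trans NtV; rewrite divr_gt0.
by rewrite ler_pdivrMr// mulrC -ler_pdivrMr.
Qed.

Lemma cvg_harmonic_mean (R : archiRealFieldType) (u : R ^nat) (l : R) :
  (forall n, 0 < u n) -> u @ \oo --> l -> harmonic_mean u @ \oo --> l.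
Proof.
(* When [l = 0] the inverses have no finite limit, so a squeeze between 0 and the arithmetic means
   replaces inversion. *)
move=> u0 ul; have [l0|l0] := eqVneq l 0.
  rewrite l0 in ul *; apply: (squeeze_cvgr (f := cst 0)
    (h := arithmetic_mean u)); [|exact: cvg_cst|exact: cesaro].
  apply: nearW => n; rewrite ltW ?harmonic_mean_gt0//=.
  exact: harmonic_le_arithmetic_mean.
have /cesaro : (fun n => (u n)^-1) @ \oo --> l^-1 by exact: cvgV.
move=> /cvgV; rewrite invr_eq0 invrK => /(_ l0).
apply: cvg_trans; apply: near_eq_cvg; apply: nearW => n /=.
by rewrite /harmonic_mean/arithmetic_mean /= invfM invrK.
Qed.

(* mu n is the n.+1-dimensional law; its last coordinate is ord_max. *)
Theorem mainTheorem5 (R : realType)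
    (mu : forall n : nat, probability (n.+1.-tuple R) R)
    (mu_second_moment : forall n, finite_second_moment (mu n))
    (mu_independent : forall n,
       mutually_independent (mu n) (fun i : 'I_n.+1 => @coord_proj R n.+1 i))
    (mu_marginal : forall n (A : set (n.+1.-tuple R)), measurable A ->
       pushforward (mu n.+1) (@init_proj R n.+1) A = mu n A)
    (mean_neq0 : forall n, mean_vec (mu n) ord_max 0 != 0)
    (std_gt0 : forall n, 0 < std_dev (mu n) (@coord_proj R n.+1 ord_max))
    (ratio_cvg : cvgn (fun n => std_dev (mu n) (@coord_proj R n.+1 ord_max)
                                / `|mean_vec (mu n) ord_max 0|)) :
  cvgn (fun n => G2 (mu n)) /\
  limn (fun n => G2 (mu n)) =
    limn (fun n => std_dev (mu n) (@coord_proj R n.+1 ord_max)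
                   / `|mean_vec (mu n) ord_max 0|).
Proof.
pose s n := std_dev (mu n) (@coord_proj R n.+1 ord_max).
pose m n := mean_vec (mu n) ord_max 0.
pose r n := s n / `|m n|.
(* Coordinate [i] has the same moments under [mu n] as under [mu i], the first law that contains it
   and where it comes last. *)
have momentE n (i : 'I_n.+1) :
    mean_vec (mu n) i 0 = m i /\
    fine ('V_(mu n)[@coord_proj R n.+1 i])%E = s i ^+ 2.
  have law A : measurable A -> mu n (@coord_proj R n.+1 i @^-1` A) =
      mu i (@coord_proj R i.+1 ord_max @^-1` A).
    by move=> mA; exact: law_coord_proj.
  have [EE VE] := eq_law_expectation_variance law
    (Lfun2_coord_proj i (mu_second_moment n))
    (Lfun2_coord_proj ord_max (mu_second_moment i)).
  rewrite VE /m !mxE EE /s /std_dev sqr_sqrtr//.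
  by rewrite fine_ge0// variance_ge0.
have r0 n : 0 < r n by rewrite divr_gt0 ?std_gt0// normr_gt0 mean_neq0.
have G2E n : G2 (mu n) = Num.sqrt (harmonic_mean (fun k => r k ^+ 2) n).
  rewrite G2_indep//; last first.
    by move=> i; rewrite (momentE n i).2 exprn_gt0// std_gt0.
  (* At index [n] the harmonic mean runs over [n.+1] terms, which is the dimension of [mu n]. *)
  rewrite /harmonic_mean/= /series/= big_mkord; congr (Num.sqrt (_ / _)).
  apply: eq_bigr => i _; have [-> ->] := momentE n i.
  by rewrite /r expr_div_n real_normK ?num_real// invf_div.
have rl : r @ \oo --> limn r := ratio_cvg.
have rl0 : 0 <= limn r by apply: limr_ge => //; apply: nearW => n; exact: ltW.
have G2l : G2 (mu n) @[n --> \oo] --> limn r.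
  (* The limit is nonnegative, hence the square root of its square; it remains to pass to the limit
     under the root. *)
  rewrite -[limn r]ger0_norm// -sqrtr_sqr.
  rewrite (_ : (fun n => G2 (mu n)) =
    Num.sqrt \o harmonic_mean (fun k => r k ^+ 2)); last exact/funext.
  apply: continuous_cvg; first exact: sqrt_continuous.
  apply: cvg_harmonic_mean => [n|]; first by rewrite exprn_gt0.
  by rewrite expr2; under eq_fun do rewrite expr2; exact: cvgM.
by split; [exact: cvgP G2l | exact: cvg_lim G2l].
Qed.
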